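(* Any Palm specification specifies a random field compatible with it. That is, for every Palm specification ${\rm Q}^{\Pi}=\{q_V^z, z\in X^t, t\in\mathbb{Z}^d\setminus V, V\in W\}$ there exists a unique (positive) random field $P$ whose Palm distribution coincides with ${\rm Q}^{\Pi}$, i.e. such that $$\frac{P_{V\cup\{t\}}(xz)}{P_{\{t\}}(z)}=q_V^z(x)$$ for all $V\in W$, $t\in\mathbb{Z}^d\setminus V$, $x\in X^V$, $z\in X^t$.
   Context: $X\subset\mathbb{R}$ is a finite set with $1<|X|<\infty$, and $d\ge 1$. For $S\subset\mathbb{Z}^d$, $W(S)$ is the set of all finite subsets of $S$, and $W=W(\mathbb{Z}^d)$. $X^S$ is the set of configurations on $S$ (functions $S\to X$). Braces are omitted for one-point sets, e.g. $X^t=X^{\{t\}}$, $t\cup V=\{t\}\cup V$. For disjoint $S,T$ and $x\in X^S$, $y\in X^T$, $xy\in X^{S\cup T}$ is the concatenation. A random field is a probability measure $P$ on $X^{\mathbb{Z}^d}$ with the $\sigma$-algebra generated by cylinder sets; $P_V$ denotes its marginal on $X^V$, $V\in W$. All random fields are assumed positive: $P_V(x)>0$ for all $V\in W$, $x\in X^V$. The Palm distribution of $P$ is the system $\{Q_V^z, z\in X^t, t\in\mathbb{Z}^d\setminus V, V\in W\}$ with $Q_V^z(x)=P_{V\cup\{t\}}(xz)/P_{\{t\}}(z)$. A Palm specification is a system ${\rm Q}^{\Pi}=\{q_V^z, z\in X^t, t\in\mathbb{Z}^d\setminus V, V\in W\}$ of strictly positive probability distributions $q_V^z$ on $X^V$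 such that: 1. for all distinct $t,s\in\mathbb{Z}^d$, all $V\in W(\mathbb{Z}^d\setminus\{t,s\})$ and $x\in X^t$, $y\in X^s$, $u\in X^V$, $$q_t^y(x)\,q_{s\cup V}^x(yu)=q_s^x(y)\,q_{t\cup V}^y(xu);$$ 2. for all disjoint $I,V\in W$, all $t\in\mathbb{Z}^d\setminus(V\cup I)$ and $x\in X^V$, $z\in X^t$, $$\sum_{y\in X^I}q_{V\cup I}^z(xy)=q_V^z(x).$$ *)

(* Defs.v *)
From HB Require Import structures.
From mathcomp Require Import all_boot all_order all_algebra finmap.
From mathcomp Require Import all_classical all_reals all_analysis.

Set Implicit Arguments.
Unset Strict Implicit.
Unset Printing Implicit Defensive.

Import Order.TTheory GRing.Theory Num.Theory.

Local Open Scope classical_set_scope.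
Local Open Scope ring_scope.

Notation site d := 'rV[int]_d.

Definition conf (R : realType) (X : {fset R}) (d : nat) (V : {fset site d}) :=
  {ffun V -> X}.

Section Concatenation.
Variables (R : realType) (X : {fset R}) (d : nat).

Lemma mem_fsetU_right (S T : {fset site d}) (u : (S `|` T)%fset) :
  ~ (val u \in S) -> val u \in T.
Proof. by move=> /negP uS; have := valP u; rewrite inE (negPf uS). Qed.

(* [S] and [T] are meant to be disjoint; on an overlap [x] would prevail. *)
Definition conf_cat (S T : {fset site d}) (x : conf X S) (y : conf X T) :
    conf X (S `|` T)%fset :=
  [ffun u : (S `|` T)%fset =>
    match decP (@idP (val u \in S)) with
    | left uS => x [` uS]%fset
    | right uS => y [` mem_fsetU_right uS]%fset
    end].

End Concatenation.

Section ConfigurationSpace.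
Variables (R : realType) (X : {fset R}) (hX : (1 < #|` X|)%N) (d : nat).

(* The whole space X^(Z^d). A [measurableType] is required to be inhabited,
   hence the dependence on the proof [hX]. *)
Definition full_conf & (1 < #|` X|)%N : Type := site d -> X.

Lemma alphabet_inhabited : exists a, a \in X.
Proof. by apply/fset0Pn; rewrite -cardfs_gt0 (ltn_trans _ hX). Qed.

HB.instance Definition _ := Choice.copy (full_conf hX) (site d -> X).
HB.instance Definition _ := isPointed.Build (full_conf hX)
  (fun=> [` xchooseP alphabet_inhabited]%fset).

Definition conf_restrict (V : {fset site d}) (w : full_conf hX) : conf X V :=
  [ffun v : V => w (val v)].

Definition cylinders : set (set (full_conf hX)) :=
  [set A | exists (V : {fset site d}) (B : set (conf X V)),
             A = conf_restrict V @^-1` B].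

Definition random_field := probability (g_sigma_algebraType cylinders) R.

Definition marginal (P : random_field) (V : {fset site d}) (x : conf X V) : R :=
  fine (P (conf_restrict V @^-1` [set x])).

Definition positive_field (P : random_field) : Prop :=
  forall (V : {fset site d}) (x : conf X V), 0 < marginal P x.

(* A family of functions indexed by [V], by [t] and by [z : X^{t}]. It is
   total in [t], but only its values at [t \notin V] are meaningful: every
   statement about such a family is restricted to these indices. *)
Definition palm_family := forall (V : {fset site d}) (t : site d),
  conf X [fset t]%fset -> conf X V -> R.

Definition palm_distribution (P : random_field) : palm_family :=
  fun V t z x => marginal P (conf_cat x z) / marginal P z.

Definition has_palm_distribution (P : random_field) (q : palm_family) : Prop :=
  forall (V : {fset site d}) (t : site d), t \notin V ->
  forall (x : conf X V) (z : conf X [fset t]%fset),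
    palm_distribution P z x = q V t z x.

Record palm_specification (q : palm_family) : Prop := PalmSpecification {
  palm_gt0 : forall (V : {fset site d}) (t : site d), t \notin V ->
    forall (z : conf X [fset t]%fset) (x : conf X V), 0 < q V t z x;
  palm_sum1 : forall (V : {fset site d}) (t : site d), t \notin V ->
    forall z : conf X [fset t]%fset, \sum_(x : conf X V) q V t z x = 1;
  palm_exchange : forall (t s : site d), t != s ->
    forall V : {fset site d}, t \notin V -> s \notin V ->
    forall (x : conf X [fset t]%fset) (y : conf X [fset s]%fset) (u : conf X V),
      q [fset t]%fset s y x * q ([fset s] `|` V)%fset t x (conf_cat y u) =
      q [fset s]%fset t x y * q ([fset t] `|` V)%fset s y (conf_cat x u);
  palm_consistent : forall I V : {fset site d}, [disjoint I & V]%fset ->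
    forall t : site d, t \notin (V `|` I)%fset ->
    forall (x : conf X V) (z : conf X [fset t]%fset),
      \sum_(y : conf X I) q (V `|` I)%fset t z (conf_cat x y) = q V t z x
}.

(* A measure of the library also takes (arbitrary) values on non-measurable
   sets, so equality of random fields is equality on the sigma-algebra. *)
Definition same_field (P P' : random_field) : Prop :=
  forall A, measurable A -> P A = P' A.

End ConfigurationSpace.

(* Main.v *)
Require Import Defs.
From mathcomp Require Import all_boot all_order all_algebra finmap.
From mathcomp Require Import all_classical all_reals all_analysis.

From HB Require Import structures.
From mathcomp Require Import ring.

(** Write [cond V t w] for the prescribed conditional mass [q_V^z(x)], where
    [x] and [z] are read off a configuration [w] of the whole lattice. If a
    compatible field [P] exists, Bayes' formula for two sites forces
    [P_t / P_s = cond {t} s / cond {s} t], which is called [ratio t s]. Hence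
    [P_e / P_o = ratio e o], and summing over the value at [e] gives
    [1 / P_o = sum_e (ratio e o)]. So [P_o] is determined, and with it all of
    [P], because [P_(o + V) = P_o * cond V o] and the other marginals are sums
    of these. This is uniqueness ([density_unique]).

    For existence these formulas are taken as definitions ([origin_mass],
    [density]). The family [density] is consistent by the consistency of the
    conditional masses, and normalized since [origin_mass] has total mass one. Its
    conditional masses given an arbitrary site [t], not only given [o], are also
    the prescribed ones ([density_palm]): this follows from the exchange axiom as
    soon as [origin_mass * ratio t o] is a function of the value at [t] alone
    ([depends_on_site_mass]). This is where a third site enters: the exchange
    axiom for two sites and one further site makes the ratios multiply like
    quotients, [ratio t s * ratio s u = ratio t u] ([ratio_mul]).

    The consistent family is then extended to a probability measure by the
    theorem of Kolmogorov ([kolmogorov_extension]). On the algebra of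
    cylinders the family defines a finitely additive mass; sigma-additivity is
    automatic, since the configuration space is compact and cylinders are
    clopen, so a cylinder is never an infinite disjoint union of nonempty
    cylinders. Caratheodory's theorem concludes.

    Dependent types are kept out of the way by working with functions of whole
    configurations that depend on finitely many sites ([depends_on]), and by
    summing over the values on a finite set of sites ([sum_over]). *)

Set Implicit Arguments.
Unset Strict Implicit.
Unset Printing Implicit Defensive.

Import Order.TTheory GRing.Theory Num.Theory.

Local Open Scope classical_set_scope.
Local Open Scope fset_scope.
Local Open Scope ring_scope.

(** * Functions of finitely many sites and their sums *)

Section FiniteSums.
Context (R : realType) (X : {fset R}) (hX : (1 < #|` X|)%N) (d : nat).
Notation full := (full_conf d hX).
Implicit Types (V I W : {fset site d}) (w : full) (t s : site d).

Definition depends_on V (U : Type) (G : full -> U) : Prop :=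
  forall w w', (forall s, s \in V -> w s = w' s) -> G w = G w'.

Definition glue V (x : conf X V) w : full :=
  fun s => if insub s is Some v then x v else w s.

Definition sum_over V (G : full -> R) w : R := \sum_(x : conf X V) G (glue x w).

Lemma glue_in V (x : conf X V) w (v : V) : glue x w (val v) = x v.
Proof. by rewrite /glue valK. Qed.

Lemma glue_out V (x : conf X V) w s : s \notin V -> glue x w s = w s.
Proof. by move=> sV; rewrite /glue insubN. Qed.

Lemma eq_glue V (x : conf X V) w w' s :
  s \in V -> glue x w s = glue x w' s.
Proof. by move=> sV; rewrite (_ : s = val [` sV]) // !glue_in. Qed.

Lemma restrict_glue V (x : conf X V) w : conf_restrict V (glue x w) = x.
Proof. by apply/ffunP => v; rewrite ffunE glue_in. Qed.

Lemma glue_restrict V w w' s :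
  s \in V -> glue (conf_restrict V w) w' s = w s.
Proof. by move=> sV; rewrite (_ : s = val [` sV]) // glue_in ffunE. Qed.

Lemma eq_restrict V w w' :
  (forall s, s \in V -> w s = w' s) -> conf_restrict V w = conf_restrict V w'.
Proof. by move=> e; apply/ffunP => v; rewrite !ffunE; apply/e/valP. Qed.

Lemma restrict_eq V w w' s :
  conf_restrict V w = conf_restrict V w' -> s \in V -> w s = w' s.
Proof. by move=> e sV; have /ffunP/(_ [` sV]) := e; rewrite !ffunE. Qed.

Lemma cat_restrict V I w :
  conf_cat (conf_restrict V w) (conf_restrict I w) = conf_restrict (V `|` I) w.
Proof. by apply/ffunP => v; rewrite !ffunE; case: decP => h; rewrite ffunE. Qed.

Lemma glue_cat V I (x : conf X V) (y : conf X I) w :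
  [disjoint V & I] -> glue (conf_cat x y) w = glue y (glue x w).
Proof.
move=> dVI; apply/funext => s.
have [sU|] := boolP (s \in V `|` I); last first.
  move=> sU; rewrite glue_out//; move: sU; rewrite in_fsetU negb_or.
  by move=> /andP[? ?]; rewrite !glue_out.
rewrite (_ : s = val [` sU]) // glue_in ffunE; case: decP => h.
- rewrite glue_out; first by rewrite -(glue_in x w).
  by move/fdisjointP: dVI; apply.
- by rewrite -(glue_in y (glue x w)).
Qed.

Lemma glueC V I (x : conf X V) (y : conf X I) w :
  [disjoint V & I] -> glue x (glue y w) = glue y (glue x w).
Proof.
move=> dVI; apply/funext => s.
have [sV|sV] := boolP (s \in V).
  have sI : s \notin I by move/fdisjointP: dVI; apply.
  by rewrite [RHS]glue_out//; apply: eq_glue.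
rewrite glue_out//; have [sI|sI] := boolP (s \in I); first exact: eq_glue.
by rewrite !glue_out.
Qed.

Lemma glue0 (x : conf X fset0) w : glue x w = w.
Proof. by apply/funext => s; rewrite glue_out. Qed.

Lemma sum_over0 G w : sum_over fset0 G w = G w.
Proof.
rewrite /sum_over (eq_bigr (fun=> G w)); last by move=> x _; rewrite glue0.
by rewrite sumr_const card_ffun -(cardfE fset0) cardfs0 expn0.
Qed.

Lemma eq_sum_over V G H w : G =1 H -> sum_over V G w = sum_over V H w.
Proof. by move=> e; apply: eq_bigr => x _; rewrite e. Qed.

Lemma sum_overU V I G w : [disjoint V & I] ->
  sum_over (V `|` I) G w = sum_over V (sum_over I G) w.
Proof.
move=> dVI; rewrite /sum_over pair_big /=.
pose f (p : conf X V * conf X I) := conf_cat p.1 p.2.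
rewrite (reindex f); last first.
  exists (fun z => (conf_restrict V (glue z w), conf_restrict I (glue z w))).
  - move=> [x y] _ /=; rewrite /f/= glue_cat//; congr (_, _).
      by rewrite -glueC// restrict_glue.
    by rewrite restrict_glue.
  - by move=> z _; rewrite /f/= cat_restrict restrict_glue.
by apply: eq_bigr => -[x y] _ /=; rewrite /f/= glue_cat.
Qed.

Lemma sum_overC V I G w : [disjoint V & I] ->
  sum_over V (sum_over I G) w = sum_over I (sum_over V G) w.
Proof.
move=> dVI; rewrite /sum_over exchange_big/=.
by apply: eq_bigr => y _; apply: eq_bigr => x _; rewrite glueC// fdisjoint_sym.
Qed.

Lemma depends_glue V I (U : Type) (F : full -> U) (x : conf X I) w :
  depends_on V F -> [disjoint I & V] -> F (glue x w) = F w.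
Proof.
move=> dF dIV; apply: dF => s sV; rewrite glue_out//.
by move: dIV; rewrite fdisjoint_sym => /fdisjointP; apply.
Qed.

Lemma sum_over_mull V I (F G : full -> R) w : depends_on V F ->
  [disjoint I & V] ->
  sum_over I (fun w => F w * G w) w = F w * sum_over I G w.
Proof.
move=> dF dIV; rewrite /sum_over mulr_sumr; apply: eq_bigr => x _.
by rewrite (depends_glue _ _ dF).
Qed.

Lemma depends_onS V W (U : Type) (G : full -> U) :
  V `<=` W -> depends_on V G -> depends_on W G.
Proof. by move=> /fsubsetP VW dG w w' e; apply: dG => s /VW /e. Qed.

(** Interpolate: go from [w] to [w'] by first changing the sites outside [V],
    then the sites of [V] that lie outside [W]. *)
Lemma depends_onI V W (U : Type) (G : full -> U) :
  depends_on V G -> depends_on W G -> depends_on (V `&` W) G.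
Proof.
move=> dV dW w w' e.
pose w2 : full := fun s => if s \in V then w s else w' s.
rewrite (dV w w2); last by move=> s sV; rewrite /w2 sV.
apply: dW => s sW; rewrite /w2; case: ifP => // sV.
by apply: e; rewrite in_fsetI sV.
Qed.

Lemma depends_on_sum V I G :
  depends_on (V `|` I) G -> depends_on V (sum_over I G).
Proof.
move=> dG w w' e; apply: eq_bigr => x _; apply: dG => s.
rewrite in_fsetU; have [sI _|sI] := boolP (s \in I); first exact: eq_glue.
by rewrite orbF => sV; rewrite !glue_out// e.
Qed.

Lemma depends_on_op2 V (A B C : Type) (op : A -> B -> C) F G :
  depends_on V F -> depends_on V G -> depends_on V (fun w => op (F w) (G w)).
Proof. by move=> dF dG w w' e; rewrite (dF _ _ e) (dG _ _ e). Qed.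

Lemma sum_over_gt0 V G w : (forall w', 0 < G w') -> 0 < sum_over V G w.
Proof.
move=> G0; rewrite /sum_over (bigD1 (conf_restrict V w))//=.
by rewrite ltr_pwDl// sumr_ge0// => x _; apply: ltW.
Qed.

End FiniteSums.

(** * The marginals forced by a Palm specification *)

Section PalmDensities.
Context (R : realType) (X : {fset R}) (hX : (1 < #|` X|)%N) (d : nat).
Context (q : palm_family X d) (hq : palm_specification q).
Notation full := (full_conf d hX).
Implicit Types (V I : {fset site d}) (w : full) (t s : site d).

Definition cond V t w : R :=
  @q V t (conf_restrict [fset t] w) (conf_restrict V w).

Lemma cond_gt0 V t w : t \notin V -> 0 < cond V t w.
Proof. by move=> tV; exact: palm_gt0. Qed.

Lemma depends_on_cond V t : depends_on (t |` V) (cond V t).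
Proof.
move=> w w' e; rewrite /cond.
rewrite (@eq_restrict _ _ _ _ V w w'); last first.
  by move=> s sV; apply: e; rewrite !inE sV orbT.
congr (@q _ _ _ _); apply: eq_restrict => s; rewrite inE => /eqP ->; apply: e.
by rewrite !inE eqxx.
Qed.

Lemma cond_exchange t s V w : t != s -> t \notin V -> s \notin V ->
  cond [fset t] s w * cond (s |` V) t w = cond [fset s] t w * cond (t |` V) s w.
Proof.
move=> ts tV sV.
have := palm_exchange hq ts tV sV (conf_restrict [fset t] w)
  (conf_restrict [fset s] w) (conf_restrict V w).
by rewrite !cat_restrict.
Qed.

Lemma restrict1_glue I t (y : conf X I) w : t \notin I ->
  conf_restrict [fset t] (glue y w) = conf_restrict [fset t] w.
Proof.
by move=> tI; apply: eq_restrict => s; rewrite inE => /eqP ->; exact: glue_out.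
Qed.

Lemma sum_over_cond V I t w : [disjoint V & I] -> t \notin V `|` I ->
  sum_over I (cond (V `|` I) t) w = cond V t w.
Proof.
move=> dVI tVI; have dIV : [disjoint I & V] by rewrite fdisjoint_sym.
have := palm_consistent hq dIV tVI (conf_restrict V w) (conf_restrict [fset t] w).
rewrite /cond => <-; apply: eq_bigr => y _.
rewrite restrict1_glue; last by apply: contra tVI; rewrite inE orbC => ->.
rewrite -cat_restrict restrict_glue; congr (q _ (conf_cat _ _)).
by apply: (depends_glue (V := V)) => // ? ? /eq_restrict.
Qed.

Lemma sum_over_cond1 V t w : t \notin V -> sum_over V (cond V t) w = 1.
Proof.
move=> tV; rewrite -(palm_sum1 hq tV (conf_restrict [fset t] w)).
by apply: eq_bigr => x _; rewrite /cond restrict1_glue// restrict_glue.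
Qed.

Lemma cond0 t w : cond fset0 t w = 1.
Proof. by rewrite -(@sum_over_cond1 fset0 t w)// sum_over0. Qed.

(** The quotient [P_t / P_s] of the one-site marginals that the conditional
    probabilities force, by Bayes' formula. *)
Definition ratio t s w : R := cond [fset t] s w / cond [fset s] t w.

Lemma notin_fset1 t s : t != s -> t \notin [fset s].
Proof. by rewrite inE. Qed.

Lemma ratio_gt0 t s w : t != s -> 0 < ratio t s w.
Proof. by move=> ts; rewrite divr_gt0// cond_gt0 ?notin_fset1// eq_sym. Qed.

Lemma ratioV t s w : (ratio t s w)^-1 = ratio s t w.
Proof. by rewrite /ratio invf_div. Qed.

Lemma depends_on_ratio t s : depends_on [fset t; s] (ratio t s).
Proof.
apply: (depends_on_op2 (fun a b => a / b)).
  by rewrite fsetUC; apply: depends_on_cond.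
exact: depends_on_cond.
Qed.

(** For [a], [b] and one further site [c], the exchange axiom rewrites
    [ratio a b] as the quotient of the conditional masses of one and the same
    triple given [b] and given [a]. In the product, the conditional mass given the middle site
    cancels. *)
Lemma ratio_mul t s u w : t != s -> s != u -> t != u ->
  ratio t s w * ratio s u w = ratio t u w.
Proof.
move=> ts su tu.
have st : s != t by rewrite eq_sym.
have us : u != s by rewrite eq_sym.
have ut : u != t by rewrite eq_sym.
have ratioE a b c : a != b -> a != c -> b != c ->
    ratio a b w = cond [fset a; c] b w / cond [fset b; c] a w.
  move=> ab ac bc; have ba : b != a by rewrite eq_sym.
  have := @cond_exchange a b [fset c] w ab (notin_fset1 ac) (notin_fset1 bc).
  have h1 : cond [fset b] a w != 0 by rewrite gt_eqF// cond_gt0// notin_fset1.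
  have h2 : cond [fset b; c] a w != 0.
    by rewrite gt_eqF// cond_gt0// !inE negb_or ab.
  by move=> h; apply/eqP; rewrite eqr_div// h mulrC.
rewrite (ratioE t s u)// (ratioE s u t)// (ratioE t u s)//.
rewrite [[fset u; t]]fsetUC [[fset u; s]]fsetUC [[fset t; s]]fsetUC.
have h1 : cond [fset s; u] t w != 0.
  by rewrite gt_eqF// cond_gt0// !inE negb_or ts.
have h2 : cond [fset t; u] s w != 0.
  by rewrite gt_eqF// cond_gt0// !inE negb_or st.
by field; rewrite h1 h2.
Qed.

Context (o e f : site d) (oe : o != e) (fo : f != o) (fe : f != e).

(** The only candidate for the marginal at [o], since the values of
    [P_e / P_o] over the configurations at [e] sum up to [1 / P_o]. *)
Definition origin_mass w : R := (sum_over [fset e] (ratio e o) w)^-1.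

Definition site_mass t w : R := origin_mass w * ratio t o w.

Let eo : e != o. Proof. by rewrite eq_sym. Qed.

Lemma fdisjoint11 t s : t != s -> [disjoint [fset t] & [fset s]].
Proof. by move=> ts; rewrite fdisjoint1X notin_fset1. Qed.

Lemma origin_mass_gt0 w : 0 < origin_mass w.
Proof. by rewrite invr_gt0 sum_over_gt0// => w'; exact: ratio_gt0. Qed.

Lemma depends_on_origin_mass : depends_on [fset o] origin_mass.
Proof.
have h : depends_on [fset o] (sum_over [fset e] (ratio e o)).
  by apply: depends_on_sum; rewrite fsetUC; exact: depends_on_ratio.
by move=> w w' ww'; rewrite /origin_mass (h _ _ ww').
Qed.

Lemma site_massV t w :
  (site_mass t w)^-1 = sum_over [fset e] (ratio e o) w * ratio o t w.
Proof. by rewrite /site_mass invfM invrK ratioV. Qed.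

(** The value of [w] at [o] cancels: for [t] other than [e] by the
    multiplicativity of the ratios, while [site_mass e] is compared with
    itself through the third site [f]. *)
Lemma depends_on_site_mass t : t != o -> depends_on [fset t] (site_mass t).
Proof.
move=> to; suff h : depends_on [fset t] (fun w => (site_mass t w)^-1).
  by move=> w w' /h /invr_inj.
have ot : o != t by rewrite eq_sym.
have [te|te] := eqVneq t e; last first.
  have et : e != t by rewrite eq_sym.
  suff -> : (fun w => (site_mass t w)^-1) = sum_over [fset e] (ratio e t).
    by apply: depends_on_sum; rewrite fsetUC; exact: depends_on_ratio.
  apply/funext => w; rewrite site_massV mulrC.
  rewrite -(@sum_over_mull _ _ _ _ [fset o; t]).
  - by apply: eq_sum_over => w'; rewrite mulrC ratio_mul.
  - exact: depends_on_ratio.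
  - by rewrite fdisjoint1X !inE negb_or eo et.
rewrite {}te in to ot *.
have -> : [fset e] = [fset e; o] `&` [fset e; f].
  apply/fsetP => s; rewrite !inE; have [//|_] /= := eqVneq s e.
  by have [->|//] := eqVneq s o; rewrite (negbTE (_ : o != f))// eq_sym.
apply: depends_onI.
  have h : depends_on [fset e; o] (site_mass e).
    apply: depends_on_op2; last exact: depends_on_ratio.
    by apply: depends_onS depends_on_origin_mass; rewrite fsubsetUr.
  by move=> w w' ww'; rewrite (h _ _ ww').
have ef : e != f by rewrite eq_sym.
have -> : (fun w => (site_mass e w)^-1) =
    (fun w => sum_over [fset e] (ratio e f) w * ratio f e w).
  apply/funext => w; rewrite site_massV -(@ratio_mul f o e)// mulrA.
  congr (_ * _).
  rewrite mulrC -(@sum_over_mull _ _ _ _ [fset f; o]).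
  - by apply: eq_sum_over => w'; rewrite mulrC ratio_mul.
  - exact: depends_on_ratio.
  - by rewrite fdisjoint1X !inE negb_or eo ef.
apply: depends_on_op2; last by rewrite fsetUC; exact: depends_on_ratio.
apply: (@depends_onS _ _ _ _ [fset f]); first by rewrite fsubsetUr.
by apply: depends_on_sum; rewrite fsetUC; exact: depends_on_ratio.
Qed.

Lemma bayes t w : t != o ->
  origin_mass w * cond [fset t] o w = site_mass t w * cond [fset o] t w.
Proof.
move=> to; rewrite /site_mass /ratio -mulrA divfK//.
by rewrite gt_eqF// cond_gt0// notin_fset1.
Qed.

Lemma sum_over_bayes t w : t != o ->
  sum_over [fset o] (fun w => origin_mass w * cond [fset t] o w) w
    = site_mass t w.
Proof.
move=> to; have ot : o != t by rewrite eq_sym.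
rewrite (eq_sum_over _ _ (fun w => bayes w to)) (@sum_over_mull _ _ _ _ [fset t]).
- by rewrite sum_over_cond1 ?mulr1// notin_fset1.
- exact: depends_on_site_mass.
- exact: fdisjoint11.
Qed.

(** Sum [origin_mass * cond {e} o] over both values: first over [e] it gives
    [origin_mass], first over [o] it gives [site_mass e], whose total mass is
    one by the choice of the normalization of [origin_mass]. *)
Lemma sum_origin_mass w : sum_over [fset o] origin_mass w = 1.
Proof.
have {1}-> : origin_mass =
    sum_over [fset e] (fun w => origin_mass w * cond [fset e] o w).
  apply/funext => w'; rewrite (@sum_over_mull _ _ _ _ [fset o]).
  - by rewrite sum_over_cond1 ?mulr1// notin_fset1.
  - exact: depends_on_origin_mass.
  - exact: fdisjoint11.
rewrite sum_overC ?fdisjoint11//.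
rewrite (eq_sum_over _ _ (fun w => sum_over_bayes w eo)).
rewrite (@sum_over_mull _ _ _ _ [fset o]) ?fdisjoint11//.
  by rewrite mulVf// -invr_eq0 -/(origin_mass w) gt_eqF// origin_mass_gt0.
exact: depends_on_origin_mass.
Qed.

(** Away from the origin, the law of total probability over the value at [o]. *)
Definition density V w : R :=
  if o \in V then origin_mass w * cond (V `\ o) o w
  else sum_over [fset o] (fun w => origin_mass w * cond V o w) w.

Lemma density_origin V w : o \notin V ->
  density (o |` V) w = origin_mass w * cond V o w.
Proof. by move=> oV; rewrite /density !inE eqxx /= fsetU1K. Qed.

Lemma density_sum V w : o \notin V ->
  density V w = sum_over [fset o] (density (o |` V)) w.
Proof.
move=> oV; rewrite {1}/density (negbTE oV); apply: eq_sum_over => w'.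
by rewrite density_origin.
Qed.

Lemma density0 w : density fset0 w = 1.
Proof.
rewrite density_sum// -[RHS](sum_origin_mass w); apply: eq_sum_over => w'.
by rewrite density_origin// cond0 mulr1.
Qed.

Lemma density_gt0 V w : 0 < density V w.
Proof.
have h W w' : o \notin W -> 0 < density (o |` W) w'.
  by move=> oW; rewrite density_origin// mulr_gt0 ?origin_mass_gt0 ?cond_gt0.
have [oV|oV] := boolP (o \in V).
  by rewrite -(fsetD1K oV) h// !inE eqxx.
by rewrite density_sum// sum_over_gt0// => w'; exact: h.
Qed.

Lemma depends_on_density V : depends_on V (density V).
Proof.
have h W : o \notin W -> depends_on (o |` W) (density (o |` W)).
  move=> oW.
  rewrite (_ : density _ = fun w => origin_mass w * cond W o w); last first.
    by apply/funext => w; rewrite density_origin.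
  apply: depends_on_op2; last exact: depends_on_cond.
  by apply: depends_onS depends_on_origin_mass; rewrite fsubsetUl.
have [oV|oV] := boolP (o \in V).
  by rewrite -(fsetD1K oV); apply: h; rewrite !inE eqxx.
rewrite (_ : density V = sum_over [fset o] (density (o |` V))); last first.
  by apply/funext => w; rewrite density_sum.
by apply: depends_on_sum; rewrite fsetUC; exact: h.
Qed.

Lemma sum_over_density V I w : [disjoint V & I] ->
  sum_over I (density (V `|` I)) w = density V w.
Proof.
(* With the origin present this is the consistency of the conditional
   masses; the other cases reduce to it by summing over the value at [o]. *)
have base W J w' : [disjoint W & J] -> o \notin W -> o \notin J ->
    sum_over J (density (o |` W `|` J)) w' = density (o |` W) w'.
  move=> dWJ oW oJ; rewrite density_origin// -fsetUA.
  have oWJ : o \notin W `|` J by rewrite inE negb_or oW.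
  rewrite (eq_sum_over _ _ (fun w => density_origin w oWJ)).
  rewrite (@sum_over_mull _ _ _ _ [fset o]).
  - by rewrite sum_over_cond.
  - exact: depends_on_origin_mass.
  - by rewrite fdisjointX1.
move=> dVI; have [oV|oV] := boolP (o \in V).
  have oI : o \notin I by move/fdisjointP: dVI; apply.
  rewrite -(fsetD1K oV) base// ?inE ?eqxx//.
  by apply: fdisjointWl dVI; exact: fsubD1set.
have [oI|oI] := boolP (o \in I).
  have dVI' : [disjoint V & I `\ o].
    by apply: fdisjointWr dVI; exact: fsubD1set.
  have oI' : o \notin I `\ o by rewrite !inE eqxx.
  rewrite -{1}(fsetD1K oI) sum_overU ?fdisjoint1X// density_sum//.
  apply: eq_sum_over => w'; rewrite -(base V _ w' dVI')//.
  by rewrite -fsetUA fsetUCA fsetD1K.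
rewrite density_sum// -(eq_sum_over _ _ (fun w => base V I w dVI oV oI)).
rewrite sum_overC ?fdisjoint1X//; apply: eq_sum_over => w'.
by rewrite density_sum ?fsetUA// inE negb_or oV.
Qed.

(** The conditional masses given a site other than the origin. If [o] is among
    the sites of [V], exchange [o] and [t]; otherwise sum over the value at
    [o], on which [site_mass t] does not depend. *)
Lemma density_palm V t w : t \notin V ->
  density (t |` V) w = density [fset t] w * cond V t w.
Proof.
have density1o w' : density [fset o] w' = origin_mass w'.
  by rewrite -[[fset o]]fsetU0 density_origin// cond0 mulr1.
have density1 s w' : s != o -> density [fset s] w' = site_mass s w'.
  move=> so; rewrite density_sum ?notin_fset1 1?eq_sym// -sum_over_bayes//.
  apply: eq_sum_over => w2; rewrite density_origin// notin_fset1// eq_sym//.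
move=> tV; have [to|to] := eqVneq t o.
  by move: tV; rewrite to => tV; rewrite density_origin// density1o.
have ot : o != t by rewrite eq_sym.
rewrite density1//.
have base W w' : o \notin W -> t \notin W ->
    density (t |` (o |` W)) w' = site_mass t w' * cond (o |` W) t w'.
  move=> oW tW; rewrite fsetUCA density_origin ?inE ?negb_or ?ot//.
  have c0 : cond [fset o] t w' != 0 by rewrite gt_eqF// cond_gt0 ?notin_fset1.
  apply: (mulfI c0); rewrite mulrCA.
  rewrite cond_exchange// mulrA bayes//; ring.
have [oV|oV] := boolP (o \in V).
  by rewrite -(fsetD1K oV) base// !inE ?eqxx// (negbTE tV) andbF.
rewrite density_sum ?inE ?negb_or ?ot// fsetUCA.
rewrite (eq_sum_over _ _ (fun w => base V w oV tV)).
rewrite (@sum_over_mull _ _ _ _ [fset t]) ?fdisjoint11//.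
  by rewrite fsetUC sum_over_cond ?fdisjointX1// inE negb_or tV notin_fset1.
exact: depends_on_site_mass.
Qed.

(** The construction is forced: a positive consistent family with the same
    conditional masses has one-site ratios [ratio], hence it is [density]. *)
Lemma density_unique (m : {fset site d} -> full -> R) :
  (forall V w, 0 < m V w) -> (forall w, m fset0 w = 1) ->
  (forall V, depends_on V (m V)) ->
  (forall V I w, [disjoint V & I] -> sum_over I (m (V `|` I)) w = m V w) ->
  (forall V t w, t \notin V -> m (t |` V) w = m [fset t] w * cond V t w) ->
  forall V w, m V w = density V w.
Proof.
move=> m0 m1 md ms mp.
have mo w : m [fset o] w = origin_mass w.
  have mr w' : m [fset e] w' = m [fset o] w' * ratio e o w'.
    rewrite /ratio mulrA -mp ?notin_fset1// fsetUC mp ?notin_fset1//.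
    by rewrite mulfK// gt_eqF// cond_gt0 ?notin_fset1.
  have : sum_over [fset e] (m [fset e]) w = 1.
    rewrite -(m1 w) -(@ms fset0 [fset e]) ?fset0U// fdisjoint_sym.
    exact: fdisjointX0.
  rewrite (eq_sum_over _ _ mr) (@sum_over_mull _ _ _ _ [fset o]) ?fdisjoint11//.
  by move/mulr1_eq => h; rewrite /origin_mass -h invrK.
have h V w : o \notin V -> m (o |` V) w = density (o |` V) w.
  by move=> oV; rewrite mp// mo density_origin.
move=> V w; have [oV|oV] := boolP (o \in V).
  by rewrite -(fsetD1K oV) h// !inE eqxx.
rewrite density_sum// -(@ms V [fset o]) ?fdisjointX1// fsetUC.
by apply: eq_sum_over => w'; rewrite h.
Qed.

End PalmDensities.

(** * Compactness of the configuration space *)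

Section Compactness.
Context (R : realType) (X : {fset R}) (hX : (1 < #|` X|)%N) (d : nat).
Notation full := (full_conf d hX).
Implicit Types (V I : {fset site d}) (A B : set full).

(** The configuration space with the topology of pointwise convergence, [X]
    being discrete. *)
Definition ptws_conf & (1 < #|` X|)%N : Type :=
  {ptws site d -> discrete_topology X}.
HB.instance Definition _ := Topological.copy (ptws_conf hX)
  {ptws site d -> discrete_topology X}.
HB.instance Definition _ := Pointed.copy (ptws_conf hX) full.
Let space : ptopologicalType := ptws_conf hX.

Lemma space_compact : compact [set: space].
Proof.
have fin (s : site d) : finite_set [set: discrete_topology X].
  exact: (@finite_finset X [set: X]).
have := tychonoff (fun s => finite_compact (fin s)).
set A := (X in compact X -> _).
by suff -> : A = [set: space] by []; rewrite eqEsubset.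
Qed.

Lemma depends_on_open V A : depends_on V A -> open (A : set space).
Proof.
move=> dA; rewrite openE => w Aw; rewrite /interior.
have h : \forall w' \near (w : space), forall v : V, w' (val v) = w (val v).
  apply: (@filter_forall space V (fun v w' => w' (val v) = w (val v))
    (nbhs (w : space))) => v.
  exact: (@proj_continuous _ (fun _ : site d => discrete_topology X)
    (val v) w _ (discrete_set1 (w (val v) : discrete_topology X))).
move: h; apply: (@filterS space (nbhs (w : space)) _) => w' hw'.
have <- : A w = A w' by apply: dA => s sV; rewrite -(hw' [` sV]).
exact: Aw.
Qed.

(** The complement of the cylinder [A] is open as well; adding it to the family
    gives an open cover of the whole space, which is compact. *)
Lemma finite_cylinder_cover (F : nat -> set full) A :
  (exists V, depends_on V A) -> (forall n, exists V, depends_on V (F n)) ->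
  (A `<=` \bigcup_n F n)%classic ->
  exists N, forall w, A w -> exists2 n, (n < N)%N & F n w.
Proof.
move=> [V dA] dF AF.
pose G n : set space := if n is n'.+1 then F n' else ~` A.
have Go n : setT n -> open (G n).
  move=> _; case: n => [|n] /=; last by have [I] := dF n; exact: depends_on_open.
  by apply: (@depends_on_open V) => w w' /dA; rewrite /setC/= => ->.
have cG : ([set: space] `<=` cover setT G)%classic.
  move=> w _; have [/AF[n _ Fn]|nA] := pselect (A w); first by exists n.+1.
  by exists 0%N.
have := space_compact; rewrite compact_cover => /(_ _ _ _ Go cG)[D _ DG].
exists (\max_(n <- D) n)%N => w Aw; have [[|n] /= nD Gn] := DG w I; first by [].
by exists n => //; apply: leq_trans (leq_bigmax_seq _ nD _).
Qed.

End Compactness.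

(** * The algebra of cylinders *)

Section CylinderAlgebra.
Context (R : realType) (X : {fset R}) (hX : (1 < #|` X|)%N) (d : nat).
Notation full := (full_conf d hX).
Implicit Types (V I : {fset site d}) (A B : set full).

Lemma cylindersP A : cylinders A <-> exists V, depends_on V A.
Proof.
split=> [[V [B ->]]|[V dA]]; exists V.
  by move=> w w' /eq_restrict e; rewrite /preimage/= e.
exists (conf_restrict V @` A)%classic; apply/seteqP; split=> [w Aw|w [w' Aw' e]].
  by exists w.
by rewrite -(dA w' w)// => s /(restrict_eq e).
Qed.

Lemma cylinders0 : cylinders (set0 : set full).
Proof. by apply/cylindersP; exists fset0. Qed.

Lemma cylindersU : setU_closed (@cylinders _ _ hX d).
Proof.
move=> A B /cylindersP[V dA] /cylindersP[I dB]; apply/cylindersP.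
exists (V `|` I); apply: (depends_on_op2 or).
  by apply: depends_onS dA; exact: fsubsetUl.
by apply: depends_onS dB; exact: fsubsetUr.
Qed.

Lemma cylindersC : setC_closed (@cylinders _ _ hX d).
Proof.
move=> A /cylindersP[V dA]; apply/cylindersP; exists V => w w' e.
by rewrite /setC/= (dA _ _ e).
Qed.

(** The configuration space with the cylinders as measurable sets: the
    sigma-algebra that they generate is the one that carries random fields. *)
Definition cylinder_space : Type := full.
HB.instance Definition _ := Choice.copy cylinder_space full.
HB.instance Definition _ := Pointed.copy cylinder_space full.
HB.instance Definition _ := isAlgebraOfSets.Build default_measure_display
  cylinder_space cylinders0 cylindersU cylindersC.

End CylinderAlgebra.

(** * The extension theorem of Kolmogorov *)

Section KolmogorovExtension.
Context (R : realType) (X : {fset R}) (hX : (1 < #|` X|)%N) (d : nat).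
Notation full := (full_conf d hX).
Context (p : {fset site d} -> full -> R).
Hypotheses (p_ge0 : forall V w, 0 <= p V w) (p1 : forall w, p fset0 w = 1).
Hypothesis depends_on_p : forall V, depends_on V (p V).
Hypothesis sum_over_p : forall V I w, [disjoint V & I] ->
  sum_over I (p (V `|` I)) w = p V w.
Implicit Types (V I : {fset site d}) (A B : set full).

Definition mass_on V A : R := sum_over V (fun w => p V w * \1_A w) point.

Lemma depends_on_indic V A : depends_on V A -> depends_on V (\1_A : full -> R).
Proof.
move=> dA w w' e; rewrite !indicE; congr (_ %:R); congr nat_of_bool.
by apply/idP/idP; rewrite !in_setE (dA _ _ e).
Qed.

Lemma mass_onU V I A : depends_on V A -> [disjoint V & I] ->
  mass_on (V `|` I) A = mass_on V A.
Proof.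
move=> dA dVI; rewrite /mass_on sum_overU//; apply: eq_sum_over => w.
under eq_sum_over do rewrite mulrC.
rewrite (@sum_over_mull _ _ _ _ V) 1?fdisjoint_sym// ?sum_over_p 1?mulrC//.
exact: depends_on_indic.
Qed.

Lemma mass_onS V W A : V `<=` W -> depends_on V A -> mass_on W A = mass_on V A.
Proof.
move=> VW dA; have -> : W = V `|` (W `\` V).
  apply/fsetP => s; rewrite !inE; have [sV|] //= := boolP (s \in V).
  exact: (fsubsetP VW).
by rewrite mass_onU//; apply/fdisjointP => s sV; rewrite !inE sV.
Qed.

(** The mass of a cylinder does not depend on the finite set of sites that
    represents it; one is chosen. *)
Definition cylinder_mass (A : set (cylinder_space hX d)) : \bar R :=
  (mass_on (xget fset0 [set V | depends_on V (A : set full)]) A)%:E.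

Lemma cylinder_massE V A : depends_on V A -> cylinder_mass A = (mass_on V A)%:E.
Proof.
move=> dA; rewrite /cylinder_mass; case: xgetP => [I _ dI|/(_ V)//].
rewrite -(mass_onS (fsubsetUl V I) dA) -(mass_onS (fsubsetUr V I))//.
Qed.

Lemma mass_on_ge0 V A : 0 <= mass_on V A.
Proof. by apply: sumr_ge0 => x _; rewrite mulr_ge0// indicE ler0n. Qed.

Lemma cylinder_mass_ge0 A : (0 <= cylinder_mass A)%E.
Proof. by rewrite lee_fin mass_on_ge0. Qed.

Lemma cylinder_mass0 : cylinder_mass set0 = 0%E.
Proof.
rewrite (@cylinder_massE fset0)// /mass_on; congr EFin.
by apply: big1 => x _; rewrite indic0 mulr0.
Qed.

Lemma cylinder_massT : cylinder_mass setT = 1%E.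
Proof.
by rewrite (@cylinder_massE fset0)// /mass_on sum_over0 indicT mulr1 p1.
Qed.

Lemma cylinder_massU A B :
  cylinders A -> cylinders B -> (A `&` B)%classic = set0 ->
  cylinder_mass (A `|` B)%classic = (cylinder_mass A + cylinder_mass B)%E.
Proof.
move=> /cylindersP[V dA] /cylindersP[I dB] AB0.
have {}dA : depends_on (V `|` I) A by apply: depends_onS dA; exact: fsubsetUl.
have {}dB : depends_on (V `|` I) B by apply: depends_onS dB; exact: fsubsetUr.
have dAB : depends_on (V `|` I) (A `|` B)%classic by exact: (depends_on_op2 or).
rewrite (cylinder_massE dA) (cylinder_massE dB) (cylinder_massE dAB) -EFinD.
congr EFin; rewrite /mass_on /sum_over -big_split/=; apply: eq_bigr => x _.
rewrite -mulrDr; congr (_ * _); rewrite !indicE -natrD; congr _%:R.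
rewrite in_setU; case: (boolP (_ \in A)) => [|_]; last by rewrite add0n.
rewrite in_setE => Aw; rewrite memNset// => Bw.
by have : (A `&` B)%classic (glue x point) by []; rewrite AB0.
Qed.

Lemma cylinder_mass_bigsetU (F : nat -> set full) n :
  (forall k, cylinders (F k)) -> trivIset setT F ->
  cylinders (\big[setU/set0]_(k < n) F k) /\
  cylinder_mass (\big[setU/set0]_(k < n) F k) =
    (\sum_(k < n) cylinder_mass (F k))%E.
Proof.
move=> cF tF; elim: n => [|n [IHc IH]].
  by rewrite !big_ord0; split; [exact: cylinders0|exact: cylinder_mass0].
rewrite !big_ord_recr/=; split; first exact: cylindersU.
rewrite cylinder_massU// ?IH//; rewrite -bigcup_mkord.
apply/seteqP; split => // w [[k /= kn Fk] Fn].
by move: kn; rewrite (tF k n I I _)// ?ltnn//; exists w.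
Qed.

(** By compactness, a sequence of disjoint cylinders whose union is a cylinder
    has only finitely many nonempty terms. *)
Lemma cylinder_mass_sigma_additive :
  semi_sigma_additive cylinder_mass.
Proof.
move=> F cF tF cUF.
have [N coverN] : exists N, forall w, (\bigcup_n F n)%classic w ->
    exists2 n, (n < N)%N & F n w.
  apply: finite_cylinder_cover => [|n|//].
    exact: (iffLR (cylindersP _) cUF).
  exact: (iffLR (cylindersP _) (cF n)).
apply: cvg_near_cst; exists N => // n /= Nn.
rewrite big_mkord -(cylinder_mass_bigsetU n cF tF).2; congr cylinder_mass.
rewrite -bigcup_mkord; apply/seteqP; split=> [w [k _ Fk]|w /coverN[k kN Fk]].
  by exists k.
by exists k => //=; exact: leq_trans Nn.
Qed.

HB.instance Definition _ := isMeasure.Build _ (cylinder_space hX d) R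
  cylinder_mass cylinder_mass0 cylinder_mass_ge0 cylinder_mass_sigma_additive.

Definition kolmogorov_measure :
    set (g_sigma_algebraType (@cylinders _ _ hX d)) -> \bar R :=
  measure_extension cylinder_mass.

Let extension0 : kolmogorov_measure set0 = 0%E.
Proof. exact: (measure0 (measure_extension cylinder_mass)). Qed.

Let extension_ge0 A : (0 <= kolmogorov_measure A)%E.
Proof. exact: (measure_ge0 (measure_extension cylinder_mass)). Qed.

Let extension_sigma_additive : semi_sigma_additive kolmogorov_measure.
Proof.
exact: (@measure_semi_sigma_additive _ _ _ (measure_extension cylinder_mass)).
Qed.

HB.instance Definition _ := isMeasure.Build _ _ _ kolmogorov_measure
  extension0 extension_ge0 extension_sigma_additive.

Lemma kolmogorov_measureE A :
  cylinders A -> kolmogorov_measure A = cylinder_mass A.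
Proof. exact: (@measurable_mu_extE _ _ (cylinder_space hX d)). Qed.

Lemma kolmogorov_measureT : kolmogorov_measure setT = 1%E.
Proof.
rewrite kolmogorov_measureE ?cylinder_massT//.
by apply/cylindersP; exists fset0.
Qed.

HB.instance Definition _ := Measure_isProbability.Build _ _ _
  kolmogorov_measure kolmogorov_measureT.

(** A consistent family of finite-dimensional distributions is the family of
    marginals of a random field. *)
Theorem kolmogorov_extension :
  exists P : random_field hX d,
    forall V w, marginal P (conf_restrict V w) = p V w.
Proof.
exists (kolmogorov_measure : random_field hX d) => V w.
have dA : depends_on V
    (conf_restrict V @^-1` [set conf_restrict V w] : set full)%classic.
  by move=> w1 w2 /eq_restrict e; rewrite /preimage/= e.
rewrite /marginal [X in fine X]kolmogorov_measureE; last first.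
  by apply/cylindersP; exists V.
rewrite (cylinder_massE dA)/= /mass_on /sum_over (bigD1 (conf_restrict V w))//=.
rewrite big1 ?addr0 => [|x xw].
  rewrite indicE mem_set ?mulr1; last exact: restrict_glue.
  by apply: depends_on_p => s; exact: glue_restrict.
rewrite indicE memNset ?mulr0// => /= /esym e.
by move: xw; rewrite e restrict_glue eqxx.
Qed.

End KolmogorovExtension.

(** * Random fields and their Palm distributions *)

Section FieldMarginals.
Context (R : realType) (X : {fset R}) (hX : (1 < #|` X|)%N) (d : nat).
Notation full := (full_conf d hX).
Context (P : random_field hX d).
Implicit Types (V I : {fset site d}) (A B : set full).

Definition field_density V (w : full) : R := marginal P (conf_restrict V w).

Lemma depends_on_field_density V : depends_on V (field_density V).
Proof. by move=> w w' /eq_restrict e; rewrite /field_density e. Qed.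

Lemma field_density_glue V (x : conf X V) (w : full) :
  field_density V (glue x w) = marginal P x.
Proof. by rewrite /field_density restrict_glue. Qed.

Lemma measurable_cylinder A : cylinders A ->
  measurable (A : set (g_sigma_algebraType (@cylinders _ _ hX d))).
Proof. exact: sub_sigma_algebra. Qed.

Lemma cylinder_preimage V (D : set (conf X V)) :
  cylinders (conf_restrict V @^-1` D : set full)%classic.
Proof. by exists V, D. Qed.

(** A cylinder is the disjoint union of its traces on the finitely many
    configurations of [V]; the trace is either everything or nothing. *)
Lemma field_cylinder V A (w : full) : depends_on V A ->
  P A = (sum_over V (fun w => field_density V w * \1_A w) w)%:E.
Proof.
move=> dA; have cA : cylinders A by apply/cylindersP; exists V.
pose F (x : conf X V) := (conf_restrict V @^-1` [set x] `&` A : set full)%classic.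
pose r := index_enum (conf X V).
have AF : A = (\bigcup_(x in [set` r]) F x)%classic.
  apply/seteqP; split=> [w' Aw'|w' [x _ [_ //]]].
  by exists (conf_restrict V w') => //=; rewrite mem_index_enum.
have mF x : measurable (F x : set (g_sigma_algebraType (@cylinders _ _ hX d))).
  apply: measurableI; apply: measurable_cylinder => //.
  exact: cylinder_preimage.
rewrite [X in P X]AF measure_fin_bigcup//; last first.
  by move=> x y _ _ [w' [[/= <- _] [/= <- _]]].
rewrite -fsbig_seq ?index_enum_uniq// /sum_over -sumEFin.
apply: eq_bigr => x _; rewrite field_density_glue indicE.
have [Ax|nAx] := pselect (A (glue x w)).
  rewrite mem_set// mulr1 /marginal fineK; last first.
    apply: fin_num_measure; apply: measurable_cylinder.
    exact: cylinder_preimage.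
  congr (P _); apply/setIidPl => w' /= xw'.
  by rewrite -(dA (glue x w))// => s sV; rewrite -xw' glue_restrict.
rewrite memNset// mulr0 (_ : F x = set0) ?measure0//.
apply/seteqP; split => // w' [/= xw' Aw']; apply: nAx.
by rewrite (dA _ w')// => s sV; rewrite -xw' glue_restrict.
Qed.

Lemma field_density0 w : field_density fset0 w = 1.
Proof.
have := @field_cylinder fset0 setT w (fun _ _ _ => erefl).
rewrite probability_setT sum_over0 indicT mulr1 => -[->//].
Qed.

Lemma sum_field_density V I w : [disjoint V & I] ->
  sum_over I (field_density (V `|` I)) w = field_density V w.
Proof.
move=> dVI; pose A : set full :=
  (conf_restrict V @^-1` [set conf_restrict V w])%classic.
have dA W : V `<=` W -> depends_on W A.
  move=> VW; apply: (depends_onS VW) => w1 w2 /eq_restrict e.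
  by rewrite /A /preimage/= e.
have h W : V `<=` W -> P A = _ := fun VW => field_cylinder w (dA W VW).
have := h _ (fsubsetUl V I); rewrite (h V)// sum_overU// => -[].
have sE (G : full -> R) :
    sum_over V (fun w' => G w' * \1_A w') w = G w.
  rewrite /sum_over (bigD1 (conf_restrict V w))//= big1 ?addr0 => [|x xw].
    rewrite indicE mem_set; last exact: restrict_glue.
    rewrite mulr1; congr G; apply/funext => s.
    have [sV|sV] := boolP (s \in V); first exact: glue_restrict.
    exact: glue_out.
  rewrite indicE memNset ?mulr0// /A/= => e.
  by move: xw; rewrite -e restrict_glue eqxx.
(* The indicator of [A] selects the restriction of [w] in the sum over [V]. *)
rewrite sE// => ->; rewrite -[LHS]sE; apply: eq_sum_over => w'.
rewrite mulrC -(@sum_over_mull _ _ _ _ V); first last.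
- by rewrite fdisjoint_sym.
- exact/depends_on_indic/dA.
by apply: eq_sum_over => w2; rewrite mulrC.
Qed.

End FieldMarginals.

(** Cylinders are stable under intersection and generate the sigma-algebra. *)
Lemma field_density_inj (R : realType) (X : {fset R}) (hX : (1 < #|` X|)%N)
    (d : nat) (P P' : random_field hX d) :
  (forall V w, field_density P V w = field_density P' V w) -> same_field P P'.
Proof.
move=> e A mA; have cI : setI_closed (@cylinders _ _ hX d).
  move=> B C cB cC; have -> : (B `&` C = ~` (~` B `|` ~` C))%classic.
    by rewrite setCU !setCK.
  by apply/cylindersC/cylindersU; exact: cylindersC.
apply: (@g_sigma_algebra_measure_unique _ R
  (g_sigma_algebraType (@cylinders _ _ hX d)) (@cylinders _ _ hX d) _
  (fun=> setT) _ _ P P') => //.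
- by move=> B; exact: measurable_cylinder.
- by move=> _; apply/cylindersP; exists fset0.
- by apply/seteqP; split => // w _; exists 0%N.
- move=> B /cylindersP[V dB]; apply: etrans (field_cylinder P point dB) _.
  apply: etrans _ (esym (field_cylinder P' point dB)).
  by congr EFin; apply: eq_sum_over => w; rewrite e.
- by move=> _; exact: (le_lt_trans (probability_le1 P measurableT) (ltry 1)).
Qed.

(** A division-free form of compatibility, in terms of whole configurations. *)
Lemma palm_distributionE (R : realType) (X : {fset R}) (hX : (1 < #|` X|)%N)
    (d : nat) (P : random_field hX d) (q : palm_family X d) :
  positive_field P ->
  (has_palm_distribution P q <->
   forall V t (w : full_conf d hX), t \notin V ->
     field_density P (t |` V) w = field_density P [fset t] w * cond q V t w).
Proof.
move=> P0; split => h V t.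
  move=> w tV; rewrite /cond -h// /palm_distribution cat_restrict fsetUC.
  by rewrite mulrC divfK// gt_eqF.
move=> tV x z; pose w : full_conf d hX := glue z (glue x point).
have tVd : [disjoint V & [fset t]] by rewrite fdisjointX1.
have ez : conf_restrict [fset t] w = z by rewrite restrict_glue.
have ex : conf_restrict V w = x.
  by rewrite /w -glueC// restrict_glue.
rewrite -ez -ex /palm_distribution cat_restrict fsetUC -/(field_density P _ w).
by rewrite h// -/(field_density P _ w) mulrC mulKf// gt_eqF// P0.
Qed.

(** In dimension zero the lattice would be a single point. *)
Lemma three_sites (d : nat) : (0 < d)%N -> exists o e f : site d,
  [/\ o != e, f != o & f != e].
Proof.
case: d => // d _.
have inj (a b : int) : a != b -> const_mx a != const_mx b :> site d.+1.
  by apply: contraNneq => /matrixP/(_ 0 0); rewrite !mxE => ->.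
by exists (const_mx 0), (const_mx 1), (const_mx 2); split; exact: inj.
Qed.

Theorem theorem9 (R : realType) (X : {fset R}) (hX : (1 < #|` X|)%N)
    (d : nat) (hd : (0 < d)%N) (q : palm_family X d) :
  palm_specification q ->
  exists P : random_field hX d,
    [/\ positive_field P, has_palm_distribution P q &
        forall P' : random_field hX d,
          positive_field P' -> has_palm_distribution P' q -> same_field P' P].
Proof.
move=> hq; have [ o [ e [ f [oe fo fe]]]] := three_sites hd.
pose p : {fset site d} -> full_conf d hX -> R := density q o e.
have [P Pp] : exists P : random_field hX d,
    forall V w, marginal P (conf_restrict V w) = p V w.
  apply: kolmogorov_extension => [V w|w|V|V I w].
  - by apply/ltW/density_gt0.
  - exact: (density0 hq oe fo fe).
  - exact: depends_on_density.
  - exact: sum_over_density.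
have P0 : positive_field P.
  by move=> V x; rewrite -(restrict_glue x point) Pp; exact: density_gt0.
exists P; split => // [|P' P'0 palmP'].
  apply/palm_distributionE => // V t w tV.
  by rewrite /field_density !Pp; exact: (density_palm hq oe fo fe).
apply: field_density_inj => V w; rewrite [RHS]Pp.
apply: (density_unique hq oe).
- by move=> ? ?; exact: P'0.
- exact: field_density0.
- exact: depends_on_field_density.
- exact: sum_field_density.
- exact/palm_distributionE.
Qed.
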